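(* Let $(X,\mathcal{B},\mu,T)$ be a measure preserving $(\mathbb{N},\times)$-system and let $A\in\mathcal{B}$ with $\mu(A)>0$. Then $$\liminf_{N\to\infty}\ \mathbb{E}_{m,n\in[N]}\ \mu\big(A\cap T_{m^2+n^2}^{-1}A\big)>0.$$
   Context: $\mathbb{N}=\{1,2,\dots\}$, $[N]=\{1,\dots,N\}$, and $\mathbb{E}_{m,n\in[N]}$ denotes the average $\frac1{N^2}\sum_{m,n\in[N]}$. A measure preserving $(\mathbb{N},\times)$-system $(X,\mathcal{B},\mu,T)$ consists of a probability space $(X,\mathcal{B},\mu)$ and measure preserving transformations $T_n:X\to X$, $n\in\mathbb{N}$, with $T_{nm}=T_n\circ T_m$ for all $n,m\in\mathbb{N}$. *)

(* Defs.v *)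
From mathcomp Require Import all_boot all_order all_algebra.
From mathcomp Require Import all_classical all_reals all_analysis.

Set Implicit Arguments.
Unset Strict Implicit.
Unset Printing Implicit Defensive.

Import Order.TTheory GRing.Theory Num.Theory.

Local Open Scope classical_set_scope.
Local Open Scope ring_scope.

Definition measure_preserving (d : measure_display) (X : measurableType d)
    (R : realType) (mu : probability X R) (f : X -> X) : Prop :=
  measurable_fun setT f /\
  forall B : set X, measurable B -> mu (f @^-1` B) = mu B.

(* The index set is {1, 2, ...}: nothing is required of [T 0]. *)
Definition multiplicative_system (d : measure_display) (X : measurableType d)
    (R : realType) (mu : probability X R) (T : nat -> X -> X) : Prop :=
  (forall n : nat, (0 < n)%N -> measure_preserving mu (T n)) /\
  (forall n m : nat, (0 < n)%N -> (0 < m)%N -> T (n * m)%N = T n \o T m).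

(* At [N = 0], outside the range of interest, this is 0. *)
Definition square_average (R : realType) (N : nat)
    (F : nat -> nat -> \bar R) : \bar R :=
  (((N%:R ^+ 2)^-1)%:E *
    \sum_(1 <= m < N.+1) \sum_(1 <= n < N.+1) F m n)%E.

(* Main.v *)
Require Import Defs.
From mathcomp Require Import all_boot all_order all_algebra.
From mathcomp Require Import all_classical all_reals all_analysis.
From mathcomp Require Import zify lra.

Set Implicit Arguments.
Unset Strict Implicit.
Unset Printing Implicit Defensive.

Import Order.TTheory GRing.Theory Num.Theory.

Local Open Scope classical_set_scope.
Local Open Scope ring_scope.

(** Write phi n for mu (A `&` T n @^-1` A), and call a positive integer a^2 + b^2
    a norm: it is the norm of the Gaussian integer a + b i.  The norms form a
    multiplicative monoid.

    The dynamical input, [return_sum_ge], is that returns along the monoid of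
    norms are multiplicatively syndetic: there are finitely many norms q such
    that the sum of phi (q * n) over these q is at least mu A / 2, for every
    norm n.  Otherwise one could keep choosing norms n whose preimages
    T n @^-1` U of the set U built so far meet A in measure less than mu A / 2;
    replacing U by the union of A and T n @^-1` U would then increase its
    measure by more than mu A / 2 each time, which is impossible in a
    probability space.

    The arithmetical input, [sum_gaussian_dilation_le], is that for q = a^2 + b^2
    the number q * (m^2 + n^2) is the norm of the product (a + b i) (m + n i).
    Multiplication by a + b i is injective, and it maps the box
    B M < m <= 2 B M, 1 <= n <= M into the square [1, N]^2 as soon as a and b
    are at most B and 3 B^2 M <= N.  As phi is nonnegative, each of the sums
    of phi (q * (m^2 + n^2)) over this box is at most the sum of phi (m^2 + n^2)
    over the square.  Adding up over the finitely many q, the box, which fills a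
    fixed proportion of the square, contributes at least mu A / 2 per point; so
    the average over the square is bounded below independently of N. *)

(** * Returns along a multiplicative monoid *)

Section Returns.
Context (R : realType) (d : measure_display) (X : measurableType d).
Context (mu : probability X R) (T : nat -> X -> X).
Context (hT : multiplicative_system mu T).
Context (A : set X) (mA : measurable A).

Lemma measurable_preimageT n (B : set X) :
  (0 < n)%N -> measurable B -> measurable (T n @^-1` B).
Proof.
move=> n_gt0 mB; rewrite -[_ @^-1` _]setTI.
by have [+ _] := hT.1 n n_gt0; apply.
Qed.

Definition return_measure (n : nat) : R := fine (mu (A `&` T n @^-1` A)).

Lemma return_measure_ge0 n : 0 <= return_measure n.
Proof. exact/fine_ge0/measure_ge0. Qed.

Lemma return_measureE n : (0 < n)%N ->
  (return_measure n)%:E = mu (A `&` T n @^-1` A).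
Proof.
move=> n_gt0; rewrite fineK// fin_num_measure//.
by apply: measurableI => //; exact: measurable_preimageT.
Qed.

(** A quantitative Poincare recurrence.  If no finite Phi worked, sets U of
    measure at least k (mu A - a) could be built for all k.  Along with U one
    keeps a list Psi in S for which the measure of A `&` T n @^-1` U is at most
    the sum of the return measures of q * n; negating the conclusion for
    Phi = Psi then yields the n of the next step. *)
Lemma return_sum_ge (S : nat -> Prop) (a : R) :
    (forall n, S n -> (0 < n)%N) -> S 1%N ->
    (forall m n, S m -> S n -> S (m * n)%N) ->
    (a%:E < mu A)%E ->
  exists Phi : seq nat, (forall q, q \in Phi -> S q) /\
    forall n, S n -> a <= \sum_(q <- Phi) return_measure (q * n)%N.
Proof.
move=> S_gt0 S1 SM a_lt; apply: contrapT => noPhi.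
have low Phi : (forall q, q \in Phi -> S q) ->
    exists2 n, S n & \sum_(q <- Phi) return_measure (q * n)%N < a.
  move=> SPhi; apply: contrapT => nolow; apply: noPhi; exists Phi; split=> // n Sn.
  by rewrite leNgt; apply/negP => lt_a; apply: nolow; exists n.
have finE B : measurable B -> mu B = (fine (mu B))%:E.
  by move=> mB; rewrite fineK// fin_num_measure.
pose p := fine (mu A); have muA : mu A = p%:E by exact: finE.
have e_gt0 : 0 < p - a by rewrite subr_gt0 -lte_fin -muA.
have grow k : exists U (Psi : seq nat),
    [/\ measurable U, (k%:R * (p - a))%:E <= mu U,
        forall q, q \in Psi -> S q &
        forall n, S n -> mu (A `&` T n @^-1` U) <=
          (\sum_(q <- Psi) return_measure (q * n)%N)%:E]%E.
  elim: k => [|k [U [Psi [mU leU SPsi upU]]]].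
    exists set0, [::]; split=> //; first by rewrite mul0r measure0.
    by move=> n _; rewrite preimage_set0 setI0 measure0 big_nil.
  have [n Sn lt_a] := low _ SPsi.
  have mTU m : S m -> measurable (T m @^-1` U).
    by move=> /S_gt0 m_gt0; exact: measurable_preimageT.
  (* The list grows with the union: T m pulls A back to the return set of
     m = 1 * m, and T n @^-1` U back to the preimage of U under T (n * m). *)
  exists (A `|` T n @^-1` U), (1%N :: [seq (q * n)%N | q <- Psi]); split.
  - exact: measurableU (mTU _ Sn).
  - have fin_TU : (mu (T n @^-1` U) < +oo)%E.
      by rewrite ltey_eq fin_num_measure//; exact: mTU.
    have -> : mu (A `|` T n @^-1` U) =
        (mu A + mu U - mu (A `&` T n @^-1` U))%E.
      have [_ mu_pre] := hT.1 n (S_gt0 _ Sn); rewrite -(mu_pre U mU).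
      exact: measureUfinr mA (mTU _ Sn) fin_TU.
    have : (mu (A `&` T n @^-1` U) <= a%:E)%E.
      by apply: le_trans (upU n Sn) _; rewrite lee_fin ltW.
    have mAU : measurable (A `&` T n @^-1` U) by exact: measurableI (mTU _ Sn).
    move: leU; rewrite muA (finE _ mU) (finE _ mAU).
    rewrite -EFinD !lee_fin -natr1; lra.
  - move=> q; rewrite inE => /predU1P[->//|/mapP[r rPsi ->]].
    by apply: SM => //; exact: SPsi.
  - move=> m Sm; rewrite big_cons big_map mul1n EFinD return_measureE ?S_gt0//.
    rewrite preimage_setU setIUr -comp_preimage.
    have -> : T n \o T m = T (n * m)%N by rewrite hT.2 ?S_gt0.
    have m_gt0 := S_gt0 _ Sm.
    apply: le_trans (measureU2 _ _ _) _.
    + by apply: measurableI => //; exact: measurable_preimageT.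
    + by apply: measurableI => //; exact/mTU/SM.
    apply: leeD => //; under eq_bigr do rewrite -mulnA.
    exact/upU/SM.
have [k lt_k] : exists k : nat, (p - a)^-1 < k%:R.
  by exists (Num.truncn (p - a)^-1).+1; rewrite truncnS_gt.
have [U [_ [mU leU _ _]]] := grow k.
have := le_trans leU (probability_le1 mu mU).
by rewrite lee_fin leNgt -ltr_pdivrMr// div1r lt_k.
Qed.

End Returns.

(** * Sums of two squares and Gaussian dilations *)

(** Asking that [a] be positive only excludes 0, up to exchanging [a] and [b]; it
    makes multiplication by a + b i send points with m much larger than n to
    points with positive real part. *)
Definition sum_two_squares (q : nat) : Prop :=
  exists a b : nat, (0 < a)%N /\ q = (a ^ 2 + b ^ 2)%N.

Lemma sum_two_squares_gt0 q : sum_two_squares q -> (0 < q)%N.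
Proof. by move=> [a [b [a_gt0 ->]]]; rewrite addn_gt0 expn_gt0 a_gt0. Qed.

Lemma sum_two_squaresM p q :
  sum_two_squares p -> sum_two_squares q -> sum_two_squares (p * q)%N.
Proof.
move=> Sp Sq; have pq_gt0 : (0 < p * q)%N.
  by rewrite muln_gt0 !sum_two_squares_gt0.
move: Sp Sq pq_gt0 => [a [b [_ ->]]] [c [e [_ ->]]] pq_gt0.
(* Brahmagupta's identity: x + y i is, up to the sign of x, the product of the
   two Gaussian integers. *)
set x := `|(a * c)%N%:Z - (b * e)%N%:Z|%N; set y := (a * e + b * c)%N.
have pqE : ((a ^ 2 + b ^ 2) * (c ^ 2 + e ^ 2) = x ^ 2 + y ^ 2)%N.
  rewrite /x /y; case: (leqP (b * e) (a * c)) => h; nia.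
case: (posnP x) => [x0|x_gt0]; last by exists x, y.
exists y, x; split; last by rewrite pqE addnC.
by move: pq_gt0; rewrite pqE x0 expn_gt0 orbF.
Qed.

Section Dilation.
Context (R : realType).

Lemma ler_sum_uniq_sub (I : eqType) (s t : seq I) (F : I -> R) :
    uniq s -> uniq t -> {subset s <= t} -> (forall i, 0 <= F i) ->
  \sum_(i <- s) F i <= \sum_(i <- t) F i.
Proof.
move=> us ut st F_ge0.
have -> : \sum_(i <- s) F i = \sum_(i <- t | i \in s) F i.
  rewrite -[RHS]big_filter; apply: (perm_big _ (uniq_perm us _ _)) => /=.
    exact: filter_uniq.
  by move=> i; rewrite mem_filter andb_idr//; exact: st.
by rewrite big_mkcond ler_sum// => i _; case: ifP.
Qed.

(** The norm of (a + b i) (m + n i) is (a^2 + b^2) (m^2 + n^2), so the left-hand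
    side sums F (m^2 + n^2) over the image of a box under multiplication by
    a + b i.  The box lies in the cone b n < a m, where the real part a m - b n
    is positive. *)
Lemma sum_gaussian_dilation_le (F : nat -> R) (a b B M N : nat) :
    (forall n, 0 <= F n) -> (0 < a)%N -> (a <= B)%N -> (b <= B)%N ->
    (3 * B ^ 2 * M <= N)%N ->
  \sum_((B * M).+1 <= m < (2 * B * M).+1) \sum_(1 <= n < M.+1)
     F ((a ^ 2 + b ^ 2) * (m ^ 2 + n ^ 2))%N
  <= \sum_(1 <= m < N.+1) \sum_(1 <= n < N.+1) F (m ^ 2 + n ^ 2)%N.
Proof.
move=> F_ge0 a_gt0 aB bB BMN.
set I := index_iota (B * M).+1 _; set J := index_iota 1 M.+1.
set K := index_iota 1 N.+1.
pose D := [seq (m, n) | m <- I, n <- J].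
pose G (z : nat * nat) := F (z.1 ^ 2 + z.2 ^ 2)%N.
pose g (z : nat * nat) := ((a * z.1 - b * z.2)%N, (a * z.2 + b * z.1)%N).
have bounds z : z \in D ->
    [/\ B * M < z.1, z.1 <= 2 * B * M, 0 < z.2 & z.2 <= M]%N.
  by move=> /allpairsP[[m n]]; rewrite /= !mem_index_iota !ltnS
    => -[/andP[? ?] /andP[? ?] ->].
have cone z : z \in D -> (b * z.2 < a * z.1)%N.
  move=> /bounds[h1 _ _ h2]; apply: leq_ltn_trans (leq_mul bB h2) _.
  by apply: leq_trans h1 _; rewrite leq_pmull.
have normE z : z \in D -> G (g z) = F ((a ^ 2 + b ^ 2) * (z.1 ^ 2 + z.2 ^ 2))%N.
  by move=> /cone; rewrite /G /g /=; move: z.1 z.2 => m n h; congr F; nia.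
(* Multiplying by the conjugate a - b i recovers the norm times m + n i. *)
have g_inj : {in D &, injective g}.
  move=> [m n] [m' n'] /cone /= lt_z /cone /= lt_z' [e1 e2].
  have q_gt0 : (0 < a ^ 2 + b ^ 2)%N by rewrite addn_gt0 expn_gt0 a_gt0.
  have em : ((a ^ 2 + b ^ 2) * m = (a ^ 2 + b ^ 2) * m')%N by nia.
  have en : ((a ^ 2 + b ^ 2) * n = (a ^ 2 + b ^ 2) * n')%N by nia.
  by move/eqP: em; move/eqP: en; rewrite !eqn_pmul2l// => /eqP -> /eqP ->.
have uniq_pairs (s t : seq nat) : uniq s -> uniq t ->
    uniq [seq (m, n) | m <- s, n <- t].
  by move=> us ut; apply: allpairs_uniq => // -[? ?] [? ?].
rewrite -(big_allpairs (r1 := I) (r2 := J)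
  (F := fun z => F ((a ^ 2 + b ^ 2) * (z.1 ^ 2 + z.2 ^ 2))%N)).
rewrite -(big_allpairs (r1 := K) (r2 := K) (F := G)) -/D.
rewrite big_seq -(eq_bigr _ normE) -big_seq -(big_map g xpredT G).
apply: ler_sum_uniq_sub.
- by rewrite map_inj_in_uniq// uniq_pairs ?iota_uniq.
- by rewrite uniq_pairs ?iota_uniq.
- move=> _ /mapP[z zD ->]; have [h1 h2 h3 h4] := bounds _ zD.
  have := cone _ zD; move: h1 h2 h3 h4; rewrite /g; case: (z) => m n /= *.
  apply/allpairsP; exists ((a * m - b * n)%N, (a * n + b * m)%N).
  have amB : (a * m <= B * (2 * B * M))%N by exact: leq_mul.
  have bmB : (b * m <= B * (2 * B * M))%N by exact: leq_mul.
  have anB : (a * n <= B * M)%N by exact: leq_mul.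
  have anB' : (B * M <= B * (B * M))%N.
    by rewrite leq_pmull//; exact: leq_trans aB.
  have an0 : (0 < a * n)%N by rewrite muln_gt0 a_gt0.
  by rewrite /= !mem_index_iota; split=> //; lia.
- by move=> z; exact: F_ge0.
Qed.

End Dilation.

(** * Positivity of the averages *)

Lemma limn_einf_ge (R : realType) (u : nat -> \bar R) (l : \bar R) (n0 : nat) :
  (forall n, (n0 <= n)%N -> l <= u n)%E -> (l <= limn_einf u)%E.
Proof.
move=> le_u; rewrite limn_einf_lim; apply: lime_ge; first exact: is_cvg_einfs.
exists n0 => // n /= n0n; apply: le_ereal_inf_tmp => _ [p /= np <-].
by apply: le_u; exact: leq_trans np.
Qed.

(** With M = N %/ (3 * B ^ 2), the box of the dilation lemma has B * M ^ 2
    points, and N <= 6 * B ^ 2 * M once N >= 3 * B ^ 2; it therefore occupies at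
    least the proportion B / (36 * B ^ 4) of the square.  The successor of
    [size Phi] keeps the denominator positive. *)
Lemma square_average_return_ge (R : realType) (F : nat -> R) (Phi : seq nat)
    (a : R) (B N : nat) :
    (forall n, 0 <= F n) -> 0 <= a ->
    (forall q, q \in Phi -> sum_two_squares q) ->
    (forall n, sum_two_squares n -> a <= \sum_(q <- Phi) F (q * n)%N) ->
    (forall q, q \in Phi -> (q <= B)%N) -> (0 < B)%N ->
    (3 * B ^ 2 <= N)%N ->
  a / (36 * B ^ 3 * (size Phi).+1)%:R <=
  (N%:R ^+ 2)^-1 *
    \sum_(1 <= m < N.+1) \sum_(1 <= n < N.+1) F (m ^ 2 + n ^ 2)%N.
Proof.
move=> F_ge0 a_ge0 SPhi le_a leB B_gt0 BN.
set total := \sum_(1 <= m < _) _.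
pose M := (N %/ (3 * B ^ 2))%N.
have B2_gt0 : (0 < 3 * B ^ 2)%N by rewrite muln_gt0 expn_gt0 B_gt0.
have MN : (3 * B ^ 2 * M <= N)%N by rewrite mulnC leq_divM.
have NM : (N <= 6 * B ^ 2 * M)%N.
  have M_gt0 : (0 < M)%N by rewrite divn_gt0.
  have := ltn_ceil N B2_gt0; rewrite -/M; nia.
have N_gt0 : (0 < N)%N by exact: leq_trans BN.
have total_ge0 : 0 <= total.
  by apply: sumr_ge0 => m _; apply: sumr_ge0 => n _; exact: F_ge0.
have dilate q : q \in Phi ->
    \sum_((B * M).+1 <= m < (2 * B * M).+1) \sum_(1 <= n < M.+1)
      F (q * (m ^ 2 + n ^ 2))%N <= total.
  move=> qPhi; have := leB _ qPhi.
  have [b [e [b_gt0 ->]]] := SPhi _ qPhi => qB.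
  apply: sum_gaussian_dilation_le F_ge0 b_gt0 _ _ MN; nia.
(* Both sides are compared with the sum of F (q * (m ^ 2 + n ^ 2)) over all q in
   Phi and all (m, n) in the box: one by fixing (m, n), the other by fixing q. *)
have count : a * (B * M ^ 2)%:R <= total * (size Phi).+1%:R.
  apply: (@le_trans _ _ (\sum_(q <- Phi) total)); last first.
    rewrite big_const_seq count_predT iter_addr_0 -[leLHS]mulr_natr.
    by rewrite ler_wpM2l// ler_nat.
  apply: (@le_trans _ _ (\sum_((B * M).+1 <= m < (2 * B * M).+1)
      \sum_(1 <= n < M.+1) \sum_(q <- Phi) F (q * (m ^ 2 + n ^ 2))%N)).
    have -> : a * (B * M ^ 2)%:R =
        \sum_((B * M).+1 <= m < (2 * B * M).+1) \sum_(1 <= n < M.+1) a.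
      under eq_bigr do rewrite sumr_const_nat.
      rewrite sumr_const_nat -mulrnA mulr_natr; congr (_ *+ _); nia.
    rewrite big_seq [leRHS]big_seq; apply: ler_sum => m; rewrite mem_index_iota.
    move=> /andP[m_gt0 _]; apply: ler_sum => n _; apply: le_a.
    by exists m, n; split=> //; exact: leq_trans m_gt0.
  under eq_bigr do rewrite exchange_big/=.
  rewrite exchange_big/= big_seq [leRHS]big_seq; exact: ler_sum.
have NR_gt0 : 0 < N%:R ^+ 2 :> R by rewrite exprn_gt0// ltr0n.
have C_gt0 : (0 < 36 * B ^ 3 * (size Phi).+1)%N.
  by rewrite 2!muln_gt0 expn_gt0 B_gt0.
rewrite ler_pdivrMr ?ltr0n// -mulrA mulrC ler_pdivlMr//.
apply: (@le_trans _ _ ((36 * B ^ 3)%:R * (a * (B * M ^ 2)%:R))).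
  rewrite [leRHS]mulrCA ler_wpM2l// -natrX -natrM ler_nat.
  have : (N ^ 2 <= (6 * B ^ 2 * M) ^ 2)%N by rewrite leq_sqr.
  nia.
by rewrite [X in total * X]natrM [leRHS]mulrCA ler_wpM2l.
Qed.

Theorem proposition1p5 (R : realType) (d : measure_display)
  (X : measurableType d) (mu : probability X R) (T : nat -> X -> X)
  (hT : multiplicative_system mu T)
  (A : set X) (mA : measurable A) (A_gt0 : (0 < mu A)%E) :
  (0 < limn_einf (fun N : nat => square_average N
         (fun m n : nat => mu (A `&` T (m ^ 2 + n ^ 2)%N @^-1` A))))%E.
Proof.
pose p := fine (mu A); have muA : mu A = p%:E by rewrite fineK// fin_num_measure.
have p_gt0 : 0 < p by rewrite -lte_fin -muA.
have lt_p : ((p / 2)%:E < mu A)%E by rewrite muA lte_fin; lra.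
have S1 : sum_two_squares 1 by exists 1%N, 0%N.
have [Phi [SPhi le_Phi]] := return_sum_ge hT mA sum_two_squares_gt0 S1
  sum_two_squaresM lt_p.
pose B := (\max_(q <- Phi) q).+1.
pose c := p / 2 / (36 * B ^ 3 * (size Phi).+1)%:R.
have c_gt0 : 0 < c.
  by rewrite divr_gt0 ?divr_gt0// ltr0n 2!muln_gt0 expn_gt0.
apply: (@lt_le_trans _ _ c%:E); first by rewrite lte_fin.
apply: (@limn_einf_ge _ _ _ (3 * B ^ 2)%N) => N BN.
rewrite /square_average.
have -> : (\sum_(1 <= m < N.+1) \sum_(1 <= n < N.+1)
      mu (A `&` T (m ^ 2 + n ^ 2)%N @^-1` A) =
    (\sum_(1 <= m < N.+1) \sum_(1 <= n < N.+1)
      return_measure mu T A (m ^ 2 + n ^ 2)%N)%:E)%E.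
  rewrite -sumEFin; apply: eq_big_nat => m /andP[m_gt0 _].
  rewrite -sumEFin; apply: eq_bigr => n _.
  by rewrite (return_measureE hT mA)// addn_gt0 expn_gt0 m_gt0.
rewrite -EFinM lee_fin; apply: square_average_return_ge => //.
- exact: return_measure_ge0.
- by rewrite divr_ge0// ltW.
- by move=> q qPhi; apply: leqW; exact: leq_bigmax_seq.
Qed.
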